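(* Let $\mathbb{K}$ be a field and let $S=(\emptyset,\mathcal{F}_\lhd,k,g)$ be a triangular system in $\mathbb{K}[T_1,\dots,T_r]$. Write $\mathcal{F}_\lhd=\{f_1,\dots,f_s\}$ with $k_i:=k(f_i)$, $k_1<\dots<k_s$. Under the canonical embedding $$\iota\colon\mathbb{K}[T_1,\dots,T_r]\to\mathbb{L}[T_{k_1},\dots,T_{k_s}],\qquad \mathbb{L}:=\mathbb{K}(T_i;\ i\notin\{k_1,\dots,k_s\}),$$ the tuple $\iota(S):=(\emptyset,\iota(\mathcal{F}_\lhd),s,\iota(g))$ is a triangular system that is dense in the polynomial ring $\mathbb{L}[T_{k_1},\dots,T_{k_s}]$. Moreover, $$V(S)\neq\emptyset\quad\Longleftrightarrow\quad V(\iota(S))\neq\emptyset.$$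
   Context: Definitions, for a polynomial ring $F[T_1,\dots,T_r]$ over a field $F$ with variables ordered $T_1>\dots>T_r$ (and analogously for $\mathbb{L}[T_{k_1},\dots,T_{k_s}]$ with $T_{k_1}>\dots>T_{k_s}$, the variable $T_{k_i}$ playing the role of the $i$-th variable): For a non-constant polynomial $f$ let $k(f)$ be the smallest index of a variable occurring in $f$, i.e. $f\in F[T_{k(f)},\dots,T_r]\setminus F[T_{k(f)+1},\dots,T_r]$. Let $\mathrm{LC}_{k(f)}(f)\in F[T_{k(f)+1},\dots,T_r]$ be the leading coefficient of $f$ as a polynomial in $T_{k(f)}$. Polynomials $f_1,\dots,f_s$ are of *triangular shape* if $k(f_1)<\dots<k(f_s)$. A tuple $(\emptyset,\mathcal{F}_\lhd,k,g)$ with $\mathcal{F}_\lhd\subseteq F[T_1,\dots,T_r]$ finite, $0\le k\le r$ and $g\in F[T_1,\dots,T_r]$ is a *triangular system* if $\mathcal{F}_\lhd$ is of triangular shape, $\mathrm{LC}_{k(f)}(f)\mid g$ for all $f\in\mathcal{F}_\lhd$, and $\{k(f): f\in\mathcal{F}_\lhd\}\subseteq\{1,\dots,k\}$. It is *dense* in the polynomial ring if every variable of the ring is of the form $T_{k(f)}$ for some $f\in\mathcal{F}_\lhd$. Its solution set is $V(\emptyset,\mathcal{F}_\lhd,k,g):=V(\mathcal{F}_\lhd)\setminus V(g)$, a subset of affine space over the algebraic closure of the coefficient field; thus $V(S)\subseteq\overline{\mathbb{K}}^r$ and $V(\iota(S))\subseteq\overline{\mathbb{L}}^s$. *)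

(* Defs.v *)
From HB Require Import structures.
From mathcomp Require Import all_boot all_order all_algebra.
From mathcomp Require Import finmap.
From mathcomp.multinomials Require Import mpoly.

Set Implicit Arguments.
Unset Strict Implicit.
Unset Printing Implicit Defensive.

Import GRing.Theory.

Local Open Scope fset_scope.
Local Open Scope ring_scope.

(* The variable T_(i+1) of F[T_1, ..., T_n] is 'X_i with i : 'I_n, so every    *)
(* index of a variable below is one less than in the usual 1-based numbering.  *)

Section TriangularSystems.

Variables (F : fieldType) (n : nat).
Implicit Types f g : {mpoly F[n]}.

Definition occurs (i : 'I_n) f : bool := has (fun m : 'X_{1..n} => m i != 0%N) (msupp f).

(* k(f); the value is n when f is constant. *)
Definition mainvar f : nat := find (occurs^~ f) (enum 'I_n).

(* f as a univariate polynomial in its main variable, the other variables      *)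
(* being part of the coefficients.                                             *)
Definition mainpoly f : {poly {mpoly F[n]}} :=
  mmap (fun c : F => c%:MP%:P)
       (fun i : 'I_n => if (i : nat) == mainvar f then 'X else ('X_i)%:P) f.

Definition LC f : {mpoly F[n]} := lead_coef (mainpoly f).

(* 1 < msize f means that f is not constant. *)
Definition triangular_shape (fs : seq {mpoly F[n]}) : bool :=
  all (fun f => (1 < msize f)%N) fs && sorted ltn [seq mainvar f | f <- fs].

(* A tuple (emptyset, tsF, tsk, tsg); the empty first entry is left out. *)
Record tsystem := TSystem {
  tsF : {fset {mpoly F[n]}};
  tsk : nat;
  tsg : {mpoly F[n]}
}.

Definition triangular_system (S : tsystem) : Prop :=
  [/\ (tsk S <= n)%N,
      exists fs : seq {mpoly F[n]}, tsF S =i fs /\ triangular_shape fs,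
      forall f, f \in tsF S -> exists q, tsg S = q * LC f
    & forall f, f \in tsF S -> (mainvar f < tsk S)%N].

Definition dense (S : tsystem) : Prop :=
  forall i : 'I_n, exists2 f, f \in tsF S & mainvar f = i.

(* V(S) in the affine n-space over an extension field phi : F -> E. *)
Definition solset (E : fieldType) (phi : {rmorphism F -> E}) (S : tsystem)
    (x : 'I_n -> E) : Prop :=
  (forall f, f \in tsF S -> (map_mpoly phi f).@[x] = 0)
  /\ (map_mpoly phi (tsg S)).@[x] <> 0.

(* {k_1, ..., k_s} *)
Definition mainvars (S : tsystem) : {set 'I_n} :=
  [set i : 'I_n | has (fun f => mainvar f == i) (tsF S)].

End TriangularSystems.

(* E is an algebraic closure of F through phi (E is algebraically closed by    *)
(* its type).                                                                  *)
Definition is_alg_closure (F : fieldType) (E : closedFieldType)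
    (phi : {rmorphism F -> E}) : Prop :=
  forall x : E, algebraicOver phi x.

Section Embedding.

Variables (K : fieldType) (r : nat) (A : {set 'I_r}).

(* K(T_i; i \notin A); its j-th variable is T_(enum_val j).  Enumerations of   *)
(* subsets of 'I_r are increasing, so the order of the variables is kept.      *)
Definition ratfield : fieldType := {fraction {mpoly K[#|[predC A]|]}}.

Definition iota_coef (c : K) : {mpoly ratfield[#|A|]} :=
  (tofrac c%:MP : ratfield)%:MP.

Definition iota_var (i : 'I_r) : {mpoly ratfield[#|A|]} :=
  match decP (@idP (i \in A)) with
  | left iA => 'X_(enum_rank_in iA i)
  | right iNA =>
      (tofrac 'X_(enum_rank_in (introN idP iNA : i \in [predC A]) i)
         : ratfield)%:MP
  end.

Definition iota_mpoly (f : {mpoly K[r]}) : {mpoly ratfield[#|A|]} :=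
  mmap iota_coef iota_var f.

End Embedding.

Definition iota_system (K : fieldType) (r : nat) (S : tsystem K r) :
    tsystem (ratfield K (mainvars S)) #|mainvars S| :=
  TSystem [fset iota_mpoly (mainvars S) f | f in tsF S]
          #|` tsF S| (iota_mpoly (mainvars S) (tsg S)).

(* Main.v *)
From HB Require Import structures.
Require Import Defs.
From mathcomp Require Import all_boot all_order all_algebra.
From mathcomp Require Import finmap.
From mathcomp.multinomials Require Import mpoly.
From Stdlib Require Import Classical.

Set Implicit Arguments.
Unset Strict Implicit.
Unset Printing Implicit Defensive.

Import GRing.Theory.

Local Open Scope ring_scope.

(** Both directions of the equivalence move a point between a closed field M
containing K[T_i; i not in A], where A is the set of main variables, and a
closed field Om containing K, along a specialization: a ring W mapped to M by
sp_gen (the generic side) and to Om by sp_val (the special side), such that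
everything that vanishes generically vanishes specially.  It is a place of M
with values in Om, restricted to a subring of M; here the initial ring W is
K[T_i; i not in A].

The basic fact is lying over: a specialization extends to any y in M that is a
root of a polynomial over W whose leading coefficient does not specialize to 0
(reach_finite_at).  After inverting the leading coefficient the polynomial is
monic.  The polynomials over W vanishing at y then specialize to a family with
a common root, because no member P of that family specializes to a nonzero
constant c: evaluating P at the companion matrix C of the monic equation gives
a matrix over W with an eigenvector of eigenvalue P(y) = 0, so with determinant
0 generically, whereas the determinant specializes to a power of c.  Adjoining
all roots of a polynomial q at once shows more (lift_root): every root of the
specialization of q lifts to a root of q.

From V(S) to V(iota S): let the T_i with i not in A specialize to the given
point x, and treat the remaining variables from T_r down to T_1.  When T_k is
the main variable of f, the coordinates of x with larger index have already been
lifted, LC(f) does not vanish at x since it divides g, and lift_root yields a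
lift of x_k that annihilates f.  In the end all of x is lifted to a point that
annihilates every f, and g does not vanish there because g(x) is nonzero
(generic_point).

From V(iota S) to V(S): the coordinates of a point Y and 1/g(Y) are algebraic
over the field of fractions L, so each is a root of a nonzero polynomial over
K[T_i; i not in A].  Choose values in Om of the T_i at which no leading
coefficient of these equations vanishes; the resulting specialization extends to
all coordinates and to 1/g(Y), and their special values solve S (closed_point).

That iota(S) is a dense triangular system comes from looking at one variable at
a time: viewing f as a polynomial in T_k commutes with iota (upoly_iota), and
iota is injective, so occurrence of variables in A and leading coefficients are
preserved, while the enumeration of A preserves the order of the variables. *)

(** * Specializations of a field *)

(** A partially defined ring homomorphism from M to Om, defined on the image of
    sp_gen.  The domain is an abstract ring over M, not a subring, so that it
    can be enlarged to a polynomial ring without forming subrings of M. *)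
Record specialization (M Om : fieldType) := Specialization {
  sp_ring : comNzRingType;
  sp_gen : {rmorphism sp_ring -> M};
  sp_val : {rmorphism sp_ring -> Om};
  sp_gen_eq0 : forall w, sp_gen w = 0 -> sp_val w = 0
}.

Definition sp_ext (M Om : fieldType) (s t : specialization M Om)
    (h : {rmorphism sp_ring s -> sp_ring t}) :=
  sp_gen t \o h =1 sp_gen s /\ sp_val t \o h =1 sp_val s.

Lemma mulmx_horner_eigen (R : comNzRingType) d (C : 'M[R]_d.+1) (v : 'rV_d.+1)
    (y : R) (P : {poly R}) :
  v *m C = y *: v -> v *m horner_mx C P = P.[y] *: v.
Proof.
move=> vC; elim/poly_ind: P => [|P c IH].
  by rewrite rmorph0 mulmx0 horner0 scale0r.
rewrite rmorphD rmorphM /= horner_mx_X horner_mx_C mulmxDr mulmxA IH.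
rewrite -scalemxAl vC scalerA mul_mx_scalar -scalerDl.
by rewrite !hornerE.
Qed.

Section Extension.

Variables (M Om : fieldType) (s : specialization M Om).
Local Notation a := (sp_gen s).
Local Notation b := (sp_val s).

Lemma sp_val_gen_eq u v : a u = a v -> b u = b v.
Proof.
move=> uv; apply/eqP; rewrite -subr_eq0 -rmorphB; apply/eqP/sp_gen_eq0.
by rewrite rmorphB uv subrr.
Qed.

Lemma sp_val_poly_eq (P Q : {poly sp_ring s}) :
  map_poly a P = map_poly a Q -> map_poly b P = map_poly b Q.
Proof.
move=> PQ; apply/polyP => i; rewrite !coef_map; apply: sp_val_gen_eq.
by rewrite -!coef_map PQ.
Qed.

(** The reason is a determinant: for the companion matrix C of p, the
    determinant of P(C) is 0 in M, as y is an eigenvalue of C and P(y) = 0, but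
    specializes to a power of c. *)
Lemma monic_root_sp_val_neqC (p P : {poly sp_ring s}) (y : M) (c : Om) :
    p \is monic -> root (map_poly a p) y -> root (map_poly a P) y ->
  c != 0 -> map_poly b P <> c%:P.
Proof.
move=> p_mon py Py c0 bP.
(* horner_mx needs a dimension of the form d.+1. *)
have [d [C defC]] : exists d, exists C : 'M_d.+1, char_poly C = p.
  have := companionmxK p_mon; rewrite /companionmx.
  case E: (size p).-1 => [|d] defC; last by exists d; eexists; exact: defC.
  have p1 : p = 1.
    have /size1_polyC defp : (size p <= 1)%N by case: (size p) E => [|[]].
    by move: p_mon; rewrite defp monicE lead_coefC => /eqP->.
  by move: py; rewrite p1 rmorph1 rootC oner_eq0.
have /eigenvalueP[v vC v0] : eigenvalue (map_mx a C) y.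
  by rewrite eigenvalue_root_char -map_char_poly defC.
have detM : \det (horner_mx (map_mx a C) (map_poly a P)) = 0.
  apply/eqP/det0P; exists v => //.
  by rewrite (mulmx_horner_eigen _ vC) (rootP Py) scale0r.
rewrite -map_horner_mx det_map_mx in detM.
have /eqP := sp_gen_eq0 detM.
rewrite -det_map_mx map_horner_mx bP horner_mx_C det_scalar expf_eq0.
by rewrite (negPf c0) andbF.
Qed.

End Extension.

(** Sends y to c, on the subring generated by y over the old domain; h is what
    makes this well defined. *)
Definition horner_specialization (M Om : fieldType) (s : specialization M Om)
    (y : M) (c : Om)
    (h : forall P, (map_poly (sp_gen s) P).[y] = 0 -> (map_poly (sp_val s) P).[c] = 0) :
  specialization M Om :=
  @Specialization M Om {poly sp_ring s}
    (horner_eval y \o map_poly (sp_gen s)) (horner_eval c \o map_poly (sp_val s)) h.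

Lemma horner_specialization_ext (M Om : fieldType) (s : specialization M Om)
    (y : M) (c : Om) h :
  sp_ext (t := @horner_specialization M Om s y c h) (@polyC (sp_ring s)).
Proof. by split=> w /=; rewrite map_polyC /= /horner_eval hornerC. Qed.

Lemma horner_specialization_X (M Om : fieldType) (s : specialization M Om)
    (y : M) (c : Om) h :
  sp_gen (@horner_specialization M Om s y c h) 'X = y.
Proof. by rewrite /= map_polyX /horner_eval hornerX. Qed.

Definition reaches (M Om : fieldType) (s : specialization M Om) (y : M) :=
  exists t (h : {rmorphism sp_ring s -> sp_ring t}),
    sp_ext h /\ exists w, sp_gen t w = y.

(** The degree drop in one step of division with remainder, without dividing by
    the leading coefficient of q. *)
Lemma size_cancel_lead (R : comNzRingType) (p q : {poly R}) :
    q != 0 -> (size q <= size p)%N ->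
  (size (lead_coef q *: p
         - lead_coef p *: ('X^(size p - size q) * q))%R < size p)%N.
Proof.
rewrite -size_poly_gt0 => q_gt0 le_qp; have p_gt0 := leq_trans q_gt0 le_qp.
rewrite -[X in (_ < X)%N](prednK p_gt0) ltnS; apply/leq_sizeP => j.
rewrite leq_eqVlt coefB !coefZ coefXnM => /predU1P[<-|lt_pj].
  have -> : ((size p).-1 < size p - size q)%N = false.
    by apply/negbTE; rewrite -leqNgt -subn1 leq_sub2l.
  have -> : ((size p).-1 - (size p - size q) = (size q).-1)%N.
    by rewrite -!subn1 subnAC subKn.
  by rewrite !lead_coefE mulrC subrr.
rewrite prednK // in lt_pj.
rewrite [p`_j]nth_default // mulr0; case: ltnP => _; rewrite ?mulr0 ?subrr //.
rewrite [q`_(j - _)]nth_default ?mulr0 ?subrr //.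
by rewrite leq_subRL ?subnK // (leq_trans (leq_subr _ _)).
Qed.

(** The relations P(y) = 0 specialize to polynomials over Om that are all
    multiples of one of minimal size; that one is not constant, so y can be sent
    to any of its roots. *)
Lemma reach_integral (M : fieldType) (Om : closedFieldType)
    (s : specialization M Om) (p : {poly sp_ring s}) (y : M) :
  p \is monic -> root (map_poly (sp_gen s) p) y -> reaches s y.
Proof.
move=> p_mon py; set a := sp_gen s; set b := sp_val s.
pose J (P : {poly sp_ring s}) := (map_poly a P).[y] = 0.
have [P0 [JP0 bP0 minP0]] : exists P0, [/\ J P0, map_poly b P0 != 0
    & forall P, J P -> map_poly b P != 0 ->
        (size (map_poly b P0) <= size (map_poly b P))%N].
  have [n] := ubnP (size (map_poly b p)).
  have : J p /\ map_poly b p != 0.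
    by split; [exact/rootP | rewrite monic_neq0 // monic_map].
  elim: n p {p_mon py} => // n IH p [Jp bp] le_pn.
  have [[q [Jq bq lt_qp]]|min_p] := classic (exists q, [/\ J q, map_poly b q != 0
     & (size (map_poly b q) < size (map_poly b p))%N]).
    by apply: (IH q) => //; apply: leq_trans lt_qp _.
  exists p; split=> // q Jq bq; rewrite leqNgt; apply/negP => lt_qp.
  by apply: min_p; exists q.
have /closed_rootP[c /rootP P0c] : size (map_poly b P0) != 1%N.
  apply/negP => /eqP sP0.
  have /size1_polyC E : (size (map_poly b P0) <= 1)%N by rewrite sP0.
  apply: (@monic_root_sp_val_neqC _ _ s p P0 y (map_poly b P0)`_0) => //.
    exact/rootP.
  by rewrite -polyC_eq0 -E.
(* Pseudo-division by P0, carried out on relations so that minP0 applies to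
   the remainders. *)
have root_c P : J P -> (map_poly b P).[c] = 0.
  have [n] := ubnP (size (map_poly b P)).
  elim: n P => // n IH P le_Pn JP.
  have [->|bP] := eqVneq (map_poly b P) 0; first by rewrite horner0.
  have le_P0P := minP0 P JP bP.
  pose k := (size (map_poly b P) - size (map_poly b P0))%N.
  pose P1 := P0`_(size (map_poly b P0)).-1 *: P
             - (P`_(size (map_poly b P)).-1 *: 'X^k) * P0.
  have JP1 : J P1.
    rewrite /J rmorphB rmorphM /= !map_polyZ map_polyXn /= !hornerE.
    by rewrite JP JP0 !mulr0 subrr.
  have bP1 : map_poly b P1 =
      lead_coef (map_poly b P0) *: map_poly b P
      - lead_coef (map_poly b P) *: ('X^k * map_poly b P0).
    rewrite rmorphB rmorphM /= !map_polyZ map_polyXn /= !lead_coefE !coef_map.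
    by rewrite scalerAl.
  have lt_P1 : (size (map_poly b P1) < n)%N.
    by rewrite bP1; apply: leq_trans (size_cancel_lead bP0 le_P0P) _.
  have := IH P1 lt_P1 JP1; rewrite bP1 hornerD hornerN !hornerZ hornerM P0c !mulr0 subr0.
  by move/eqP; rewrite mulf_eq0 lead_coef_eq0 (negPf bP0) /= => /eqP.
exists (horner_specialization root_c), (@polyC (sp_ring s)); split.
  exact: horner_specialization_ext.
by exists 'X; apply: horner_specialization_X.
Qed.

(** Clears the denominators of P(1 / u) inside the ring. *)
Lemma rmorph_horner_inv (R : comNzRingType) (F : fieldType)
    (f : {rmorphism R -> F}) (u : R) (P : {poly R}) : f u != 0 ->
  f (\sum_(i < size P) P`_i * u ^+ (size P - i)) =
    f u ^+ size P * (map_poly f P).[(f u)^-1].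
Proof.
move=> fu0; rewrite (horner_coef_wide _ (size_poly _ _)) rmorph_sum mulr_sumr.
apply: eq_bigr => i _; rewrite coef_map rmorphM rmorphXn mulrCA; congr (_ * _).
by rewrite exprVn expfB.
Qed.

(** Localization at an element with nonzero special value. *)
Lemma reach_inverse (M Om : fieldType) (s : specialization M Om) (u : sp_ring s) :
  sp_val s u != 0 -> reaches s (sp_gen s u)^-1.
Proof.
move=> bu0; have au0 : sp_gen s u != 0.
  by apply: contraNneq bu0 => /sp_gen_eq0->.
have root_c P : (map_poly (sp_gen s) P).[(sp_gen s u)^-1] = 0 ->
                (map_poly (sp_val s) P).[(sp_val s u)^-1] = 0.
  move=> Pu0; have := rmorph_horner_inv P au0.
  rewrite Pu0 mulr0 => /sp_gen_eq0; rewrite rmorph_horner_inv // => /eqP.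
  by rewrite mulf_eq0 expf_eq0 (negPf bu0) andbF => /eqP.
exists (horner_specialization root_c), (@polyC (sp_ring s)); split.
  exact: horner_specialization_ext.
by exists 'X; apply: horner_specialization_X.
Qed.

Lemma sp_ext_trans (M Om : fieldType) (s t u : specialization M Om)
    (h : {rmorphism sp_ring s -> sp_ring t}) (k : {rmorphism sp_ring t -> sp_ring u}) :
  sp_ext h -> sp_ext k -> sp_ext (k \o h).
Proof.
move=> [hg hv] [kg kv]; split=> w /=.
  by rewrite -hg; apply: kg.
by rewrite -hv; apply: kv.
Qed.

(** The extensions of s do not send y to infinity: the equation satisfied by y
    keeps its degree under specialization. *)
Definition finite_at (M Om : fieldType) (s : specialization M Om) (y : M) :=
  exists p : {poly sp_ring s},
    sp_val s (lead_coef p) != 0 /\ root (map_poly (sp_gen s) p) y.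

(** Once the inverse w of the leading coefficient is adjoined, y is integral. *)
Lemma reach_finite_at (M : fieldType) (Om : closedFieldType)
    (s : specialization M Om) (y : M) :
  finite_at s y -> reaches s y.
Proof.
move=> [p [lcp py]].
have [t [h [hext [w gw]]]] := reach_inverse lcp.
have glc0 : sp_gen s (lead_coef p) != 0 by apply: contraNneq lcp => /sp_gen_eq0->.
pose n := (size p).-1.
have sp : size p = n.+1.
  rewrite prednK // size_poly_gt0; apply: contraNneq lcp => ->.
  by rewrite lead_coef0 rmorph0.
(* The quotient of p by its leading coefficient; its own leading coefficient
   is put in as 1, because w inverts the one of p only after mapping to M. *)
pose p1 : {poly sp_ring t} := 'X^n + \poly_(i < n) (w * h p`_i).
have p1_mon : p1 \is monic.
  by rewrite monicE lead_coefDl ?lead_coefXn // size_polyXn ltnS size_poly.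
have p1E : map_poly (sp_gen t) p1 = (sp_gen s (lead_coef p))^-1 *: map_poly (sp_gen s) p.
  apply/polyP => i; rewrite coefZ !coef_map coefD coefXn coef_poly.
  case: ltngtP => [lt_in|lt_ni|->] /=; rewrite ?mulr0n ?mulr1n.
  - by rewrite add0r rmorphM gw; congr (_ * _); apply: hext.1.
  - by rewrite addr0 rmorph0 nth_default ?rmorph0 ?mulr0 // sp.
  - by rewrite addr0 rmorph1 -[p`_n]lead_coefE mulVf.
have [|t' [k [kext ky]]] := @reach_integral M Om t p1 y p1_mon.
  by rewrite p1E rootZ // invr_eq0.
by exists t', (k \o h); split=> //; apply: sp_ext_trans.
Qed.

Lemma lead_coef_sp_ext (M Om : fieldType) (s t : specialization M Om)
    (h : {rmorphism sp_ring s -> sp_ring t}) (p : {poly sp_ring s}) :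
    sp_ext h -> sp_val s (lead_coef p) != 0 ->
  lead_coef (map_poly h p) = h (lead_coef p).
Proof.
move=> hext lcp; apply: lead_coef_map_eq.
by apply: contraNneq lcp => hlc0; rewrite -hext.2 /= hlc0 rmorph0.
Qed.

Lemma finite_at_ext (M Om : fieldType) (s t : specialization M Om)
    (h : {rmorphism sp_ring s -> sp_ring t}) y :
  sp_ext h -> finite_at s y -> finite_at t y.
Proof.
move=> hext [p [lcp py]]; exists (map_poly h p); split.
  by rewrite lead_coef_sp_ext // (hext.2 _ : sp_val t (h _) = _).
by rewrite -map_poly_comp (eq_map_poly hext.1).
Qed.

Lemma reach_all (M : fieldType) (Om : closedFieldType)
    (s : specialization M Om) (ys : seq M) :
    (forall y, y \in ys -> finite_at s y) ->
  exists t (h : {rmorphism sp_ring s -> sp_ring t}),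
    sp_ext h /\ exists us, map (sp_gen t) us = ys.
Proof.
elim: ys s => [|y ys IH] s fin_ys.
  by exists s, idfun; split=> //; exists [::].
have [|t [h [hext [w gw]]]] := @reach_finite_at M Om s y.
  by apply: fin_ys; rewrite mem_head.
have [y' ys_y'|t' [k [kext [us gus]]]] := IH t.
  by apply: finite_at_ext hext _; apply: fin_ys; rewrite inE ys_y' orbT.
exists t', (k \o h); split; first exact: sp_ext_trans.
by exists (k w :: us); rewrite /= gus (kext.1 w : sp_gen t' (k w) = _) gw.
Qed.

(** Extend s to all roots of q in M.  There q factors into linear terms, and so
    does its specialization, into the specialized terms; so x is the special
    value of one of the roots. *)
Lemma lift_root (M Om : closedFieldType) (s : specialization M Om)
    (q : {poly sp_ring s}) (x : Om) :
    sp_val s (lead_coef q) != 0 -> root (map_poly (sp_val s) q) x ->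
  exists t (h : {rmorphism sp_ring s -> sp_ring t}),
    sp_ext h /\ exists u, sp_val t u = x /\ root (map_poly (sp_gen s) q) (sp_gen t u).
Proof.
move=> lcq qx.
have [r defq] := closed_field_poly_normal (map_poly (sp_gen s) q).
have lcgq : sp_gen s (lead_coef q) != 0.
  by apply: contraNneq lcq => /sp_gen_eq0->.
have [z r_z|t [h [hext [us gus]]]] := @reach_all M Om s r.
  exists q; split=> //; rewrite defq rootZ ?root_prod_XsubC //.
  by rewrite lead_coef_map_eq.
have gq : map_poly (sp_gen t) (map_poly h q) =
          map_poly (sp_gen t) (h (lead_coef q) *: \prod_(u <- us) ('X - u%:P)).
  rewrite -map_poly_comp (eq_map_poly hext.1) map_polyZ rmorph_prod defq.
  rewrite lead_coef_map_eq // (hext.1 _ : sp_gen t (h _) = _) -gus big_map.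
  by congr (_ *: _); apply: eq_bigr => u _; rewrite rmorphB /= map_polyX map_polyC.
have := sp_val_poly_eq gq.
rewrite -map_poly_comp (eq_map_poly hext.2) map_polyZ rmorph_prod => vq.
have : x \in map (sp_val t) us.
  rewrite -root_prod_XsubC big_map.
  move: qx; rewrite vq rootZ ?(hext.2 _ : sp_val t (h _) = _) //.
  congr (root _ x); apply: eq_bigr => u _.
  by rewrite rmorphB /= map_polyX map_polyC.
case/mapP => u us_u ->; exists t, h; split=> //; exists u; split=> //.
rewrite defq rootZ ?lead_coef_map_eq // root_prod_XsubC -gus.
exact: map_f.
Qed.

(** * Morphisms out of multivariate polynomial rings *)

Lemma mpoly_rmorph_ext (n : nat) (R S : comNzRingType)
    (f g : {rmorphism {mpoly R[n]} -> S}) :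
  (forall c, f c%:MP = g c%:MP) -> (forall i, f 'X_i = g 'X_i) -> f =1 g.
Proof.
move=> fgC fgX p; rewrite (mpolyE p) !rmorph_sum; apply: eq_bigr => m _ /=.
rewrite -mul_mpolyC !rmorphM fgC; congr (_ * _).
by rewrite mpolyXE_id !rmorph_prod; apply: eq_bigr => i _; rewrite !rmorphXn fgX.
Qed.

Lemma rmorph_mmap (n : nat) (R S T : comNzRingType) (g : {rmorphism S -> T})
    (f : {rmorphism R -> S}) (v : 'I_n -> S) (p : {mpoly R[n]}) :
  g (mmap f v p) = mmap (g \o f) (g \o v) p.
Proof.
apply: (mpoly_rmorph_ext (f := g \o mmap f v) (g := mmap (g \o f) (g \o v))).
  by move=> c /=; rewrite !mmapC.
by move=> i /=; rewrite !mmapX !mmap1U.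
Qed.

Lemma eq_mmap (n : nat) (R S : nzRingType) (f g : R -> S) (u v : 'I_n -> S)
    (p : {mpoly R[n]}) :
  f =1 g -> u =1 v -> mmap f u p = mmap g v p.
Proof.
move=> fg uv; apply: eq_bigr => m _; rewrite fg; congr (_ * _).
exact: mmap1_eq.
Qed.

Lemma eq_mmap_occurs (F : fieldType) (n : nat) (R : comNzRingType)
    (kappa lambda : F -> R) (u v : 'I_n -> R) (f : {mpoly F[n]}) :
  kappa =1 lambda -> (forall i, occurs i f -> u i = v i) ->
  mmap kappa u f = mmap lambda v f.
Proof.
move=> kl uv; rewrite /mmap !big_seq; apply: eq_bigr => m fm; rewrite kl; congr (_ * _).
apply: eq_bigr => i _; have [->|mi] := eqVneq (m i) 0%N; first by rewrite !expr0.
by rewrite uv //; apply/hasP; exists m.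
Qed.

Lemma meval_map_mpoly (n : nat) (R S : comNzRingType) (f : {rmorphism R -> S})
    (v : 'I_n -> S) (p : {mpoly R[n]}) :
  (map_mpoly f p).@[v] = mmap f v p.
Proof.
rewrite (rmorph_mmap (meval v)); apply: eq_mmap => x /=; first exact: mevalC.
exact: mevalXU.
Qed.

Lemma map_mpoly_inj (n : nat) (R S : nzRingType) (f : {rmorphism R -> S}) :
  injective f -> injective (@map_mpoly n R S f).
Proof.
move=> inj_f p q pq; apply/mpolyP => m; apply: inj_f.
by rewrite -[LHS]mcoeff_map_mpoly pq mcoeff_map_mpoly.
Qed.

(** * Multivariate polynomials as polynomials in one variable *)

Section UnivariateView.

Variables (F : fieldType) (n : nat).
Implicit Types (f : {mpoly F[n]}).

(** Like mainpoly, but in an arbitrary variable; being a ring morphism in f, it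
    can be compared with iota_mpoly by testing on variables. *)
Definition upoly (k : nat) f : {poly {mpoly F[n]}} :=
  mmap (polyC \o @mpolyC n F)
       (fun i : 'I_n => if (i : nat) == k then 'X else ('X_i)%:P) f.

HB.instance Definition _ k := GRing.RMorphism.copy (upoly k)
  (mmap (polyC \o @mpolyC n F) (fun i : 'I_n => if (i : nat) == k then 'X else ('X_i)%:P)).

Lemma mainpolyE f : mainpoly f = upoly (mainvar f) f.
Proof. by []. Qed.

Lemma upolyC k c : upoly k c%:MP = c%:MP%:P.
Proof. by rewrite /upoly mmapC. Qed.

Lemma upolyX k (i : 'I_n) : upoly k 'X_i = if (i : nat) == k then 'X else ('X_i)%:P.
Proof. by rewrite /upoly mmapX mmap1U. Qed.

Lemma upoly_X (k : 'I_n) f : (upoly k f).['X_k] = f.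
Proof.
apply: (mpoly_rmorph_ext (f := horner_eval 'X_k \o upoly k) (g := idfun)).
  by move=> c /=; rewrite upolyC /horner_eval hornerC.
move=> i /=; rewrite upolyX /horner_eval; case: eqP => [/val_inj->|_].
  by rewrite hornerX.
by rewrite hornerC.
Qed.

Lemma upoly_noccur (k : 'I_n) f : ~~ occurs k f -> upoly k f = f%:P.
Proof.
move/hasPn => fk; rewrite [in RHS](mpolyE f) rmorph_sum /= /upoly /mmap.
rewrite !big_seq; apply: eq_bigr => m /fk; rewrite negbK => /eqP mk.
rewrite -mul_mpolyC polyCM /=; congr (_ * _).
rewrite mpolyXE_id rmorph_prod; apply: eq_bigr => i _ /=.
by case: eqP => [/val_inj->|_]; rewrite ?mk ?expr0 // rmorphXn.
Qed.

(** If f is constant as a polynomial in T_k, setting T_k to 0 does not change f,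
    so no monomial of f contains T_k. *)
Lemma occurs_upoly (k : 'I_n) f : occurs k f = (1 < size (upoly k f))%N.
Proof.
apply/idP/idP => [|s1]; last first.
  apply: contraLR s1 => /upoly_noccur->.
  by rewrite -leqNgt size_polyC leq_b1.
apply: contraLR; rewrite -leqNgt => /size1_polyC defu.
have {}defu : upoly k f = f%:P.
  by rewrite -{2}(upoly_X k f) defu hornerC.
pose z := fun i : 'I_n => if i == k then 0 else 'X_i : {mpoly F[n]}.
have f0 : mmap (@mpolyC n F) z f = f.
  have <- : (upoly k f).[0] = mmap (@mpolyC n F) z f.
    rewrite -[LHS]/(horner_eval 0 (upoly k f)) rmorph_mmap.
    apply: eq_mmap => x /=; first by rewrite /horner_eval hornerC.
    by rewrite /z /horner_eval -val_eqE; case: eqP; rewrite ?hornerX ?hornerC.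
  by rewrite defu hornerC.
apply/hasPn => m; rewrite mcoeff_msupp negbK -f0 => fm.
apply: contraNT fm => mk; apply/eqP; rewrite /mmap raddf_sum /=.
apply: big1_seq => m' /= _; rewrite mcoeffCM.
have [m'k|m'k] := eqVneq (m' k) 0%N; last first.
  by rewrite /mmap1 (bigD1 k) //= /z eqxx expr0n (negPf m'k) mul0r mcoeff0 mulr0.
have -> : mmap1 z m' = 'X_[m'].
  rewrite mpolyXE_id; apply: eq_bigr => i _; rewrite /z.
  by case: eqP => [->|//]; rewrite m'k !expr0.
rewrite mcoeffX; case: eqP => [mm'|_]; last by rewrite mulr0.
by rewrite -mm' m'k eqxx in mk.
Qed.

End UnivariateView.

(** * The embedding iota *)

Section IotaTheory.

Variables (K : fieldType) (r : nat) (A : {set 'I_r}).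
Local Notation s := #|A|.
Local Notation s' := #|[predC A]|.
Local Notation L := (ratfield K A).

(** Splits the variables into those of A and those of its complement, in the
    form in which iota_var numbers them. *)
Lemma var_split_ind (P : 'I_r -> Prop) :
    (forall j : 'I_s, P (enum_val j)) -> (forall j : 'I_s', P (enum_val j)) ->
  forall i, P i.
Proof.
move=> PA PC i; have [iA|iA] := boolP (i \in A).
  by rewrite -(enum_rankK_in iA iA).
by rewrite -(enum_rankK_in (iA : i \in [predC A]) iA).
Qed.

HB.instance Definition _ := GRing.RMorphism.copy (@iota_coef K r A)
  (@mpolyC s L \o @tofrac {mpoly K[s']} \o @mpolyC s' K).

HB.instance Definition _ := GRing.RMorphism.copy (@iota_mpoly K r A)
  (mmap (@iota_coef K r A) (@iota_var K r A)).

Lemma iota_mpolyC c : iota_mpoly A c%:MP = (tofrac c%:MP : L)%:MP.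
Proof. by rewrite /iota_mpoly mmapC. Qed.

Lemma iota_mpoly_in (j : 'I_s) : iota_mpoly A 'X_(enum_val j) = 'X_j :> {mpoly L[s]}.
Proof.
rewrite /iota_mpoly mmapX mmap1U /iota_var.
case: decP => [jA|jA]; first by rewrite enum_valK_in.
by case: (jA); exact: enum_valP.
Qed.

Lemma iota_mpoly_notin (j : 'I_s') :
  iota_mpoly A 'X_(enum_val j) = (tofrac 'X_j : L)%:MP.
Proof.
rewrite /iota_mpoly mmapX mmap1U /iota_var.
case: decP => [jA|jA]; last by rewrite enum_valK_in.
by have := enum_valP j; rewrite inE /= jA.
Qed.

(** The values of the variables under K[T] = K[T_i; i not in A][T_i; i in A],
    the part of iota that precedes the passage to fractions. *)
Definition split_var (i : 'I_r) : {mpoly {mpoly K[s']}[s]} :=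
  match decP (@idP (i \in A)) with
  | left iA => 'X_(enum_rank_in iA i)
  | right iNA => ('X_(enum_rank_in (introN idP iNA : i \in [predC A]) i))%:MP
  end.

Lemma iota_mpolyE f :
  iota_mpoly A f = map_mpoly (@tofrac _) (mmap (@mpolyC s _ \o @mpolyC s' K) split_var f).
Proof.
rewrite rmorph_mmap; apply: eq_mmap => [c|i] /=; first by rewrite map_mpolyC.
by rewrite /iota_var /split_var; case: decP => iA; rewrite ?map_mpolyX ?map_mpolyC.
Qed.

(** iota is the isomorphism regrouping the variables, with inverse unsplit,
    followed by the embedding of the coefficients into their fractions. *)
Lemma iota_mpoly_inj : injective (@iota_mpoly K r A).
Proof.
pose pre := mmap (@mpolyC s _ \o @mpolyC s' K) split_var.
pose unsplit := mmap (mmap (@mpolyC r K) (fun j : 'I_s' => 'X_(enum_val j)))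
                     (fun j : 'I_s => 'X_(enum_val j)).
have preK : cancel pre unsplit.
  apply: (mpoly_rmorph_ext (f := unsplit \o pre) (g := idfun)).
    by move=> c /=; rewrite /pre /unsplit !mmapC /= mmapC.
  move=> i /=; rewrite /pre /unsplit mmapX mmap1U /split_var.
  case: decP => iA; first by rewrite mmapX mmap1U enum_rankK_in.
  rewrite mmapC /= mmapX mmap1U enum_rankK_in // inE /=.
  exact/negP.
move=> f g; rewrite !iota_mpolyE => fg; apply: (can_inj preK).
apply: (map_mpoly_inj _ fg) => c d /eqP.
by rewrite tofrac_eq => /eqP.
Qed.

Lemma upoly_iota (j : 'I_s) f :
  upoly j (iota_mpoly A f) = map_poly (@iota_mpoly K r A) (upoly (enum_val j) f).
Proof.
apply: (mpoly_rmorph_ext (f := upoly j \o @iota_mpoly K r A)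
   (g := map_poly (@iota_mpoly K r A) \o upoly (enum_val j))) => [c|] /=.
  by rewrite iota_mpolyC !upolyC map_polyC /= iota_mpolyC.
apply: var_split_ind => i.
  rewrite iota_mpoly_in !upolyX !(inj_eq val_inj) (inj_eq (@enum_val_inj _ _)).
  by case: eqP => _; rewrite ?map_polyX // map_polyC /= iota_mpoly_in.
rewrite iota_mpoly_notin upolyC upolyX; case: eqP => [/val_inj ij|_].
  by have := enum_valP i; rewrite ij inE /= enum_valP.
by rewrite map_polyC /= iota_mpoly_notin.
Qed.

Lemma occurs_iota (j : 'I_s) (f : {mpoly K[r]}) :
  occurs j (iota_mpoly A f) = occurs (enum_val j) f.
Proof.
by rewrite !occurs_upoly upoly_iota size_map_inj_poly ?rmorph0 //; apply: iota_mpoly_inj.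
Qed.

End IotaTheory.

(** * Triangular shape of the image under iota *)

Section MainVariable.

Variables (F : fieldType) (n : nat).
Implicit Types (f : {mpoly F[n]}).

Lemma mainvar_ordP f (j : 'I_n) :
  mainvar f = j <-> occurs j f /\ (forall i : 'I_n, (i < j)%N -> ~~ occurs i f).
Proof.
rewrite /mainvar; split=> [fj|[occ_j min_j]].
  have j_lt : (find (fun i : 'I_n => occurs i f) (enum 'I_n) < size (enum 'I_n))%N.
    by rewrite fj size_enum_ord.
  split; first by have := j_lt; rewrite -has_find => /(nth_find j); rewrite fj nth_ord_enum.
  by move=> i; rewrite -fj => /(before_find j); rewrite nth_ord_enum => ->.
have has_j : has (fun i : 'I_n => occurs i f) (enum 'I_n).
  by apply/hasP; exists j; rewrite ?mem_enum.
have := nth_find j has_j; rewrite has_find in has_j.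
set k := find _ _ in has_j *; rewrite size_enum_ord in has_j.
rewrite -[k]/(val (Ordinal has_j)) nth_ord_enum => occ_k.
apply/eqP; rewrite eqn_leq; apply/andP; split; rewrite leqNgt; apply/negP.
  by move/(before_find j); rewrite nth_ord_enum occ_j.
by move=> lt_kj; have := min_j (Ordinal has_j) lt_kj; rewrite occ_k.
Qed.

Lemma occurs_msize f (j : 'I_n) : occurs j f -> (1 < msize f)%N.
Proof.
case/hasP => m fm mj; apply: leq_ltn_trans (msize_mdeg_lt fm).
by rewrite lt0n mdeg_eq0; apply: contraNneq mj => ->; rewrite mnm0E.
Qed.

End MainVariable.

Lemma ltn_enum_val (n : nat) (A : {set 'I_n}) (i j : 'I_#|A|) :
  (enum_val i < enum_val j)%N = (i < j)%N.
Proof.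
have x0 := enum_val i.
have srt : sorted (relpre val ltn) (enum A).
  rewrite /enum_mem -enumT; apply: sorted_filter; first by move=> x y z; apply: ltn_trans.
  by rewrite -sorted_map val_enum_ord iota_ltn_sorted.
have mono (k l : 'I_#|A|) : (k < l)%N -> (enum_val k < enum_val l)%N.
  move=> lt_kl; rewrite !(enum_val_nth x0).
  apply: (sorted_ltn_nth _ x0 srt) => //; rewrite ?inE -?cardE //.
  by move=> x y z; apply: ltn_trans.
case: (ltngtP i j) => [/mono//|/mono lt_ji|/val_inj->]; last exact: ltnn.
by apply/negbTE; rewrite -leqNgt ltnW.
Qed.

Section IotaMainVariable.

Variables (K : fieldType) (r : nat) (A : {set 'I_r}).
Implicit Types (f : {mpoly K[r]}) (j : 'I_#|A|).

Lemma mainvar_iota f j :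
  mainvar f = enum_val j -> mainvar (iota_mpoly A f) = j.
Proof.
move/mainvar_ordP => [occ_j min_j]; apply/mainvar_ordP; split.
  by rewrite occurs_iota.
by move=> i lt_ij; rewrite occurs_iota min_j // ltn_enum_val.
Qed.

Lemma LC_iota f j :
  mainvar f = enum_val j -> LC (iota_mpoly A f) = iota_mpoly A (LC f).
Proof.
move=> fj; rewrite /LC !mainpolyE (mainvar_iota fj) fj upoly_iota.
by rewrite lead_coef_map_inj ?rmorph0 //; apply: iota_mpoly_inj.
Qed.

End IotaMainVariable.

Section IotaSystem.

Variables (K : fieldType) (r : nat) (S : tsystem K r).
Hypothesis hS : triangular_system S.
Local Notation A := (mainvars S).

Lemma mainvar_in f : f \in tsF S -> exists j : 'I_#|A|, mainvar f = enum_val j.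
Proof.
case: hS => le_kr _ _ lt_k Ff.
pose i := Ordinal (leq_trans (lt_k f Ff) le_kr).
have iA : i \in A by rewrite inE; apply/hasP; exists f.
by exists (enum_rank_in iA i); rewrite enum_rankK_in.
Qed.

(** Polynomials of triangular shape have distinct main variables. *)
Lemma card_tsF : #|` tsF S| = #|A|.
Proof.
have [_ [fs [eqF /andP[_ srt]]] _ _] := hS.
have uniq_fs : uniq (map (@mainvar K r) fs).
  by move: srt; rewrite ltn_sorted_uniq_leq => /andP[].
have -> : #|` tsF S| = size fs.
  by apply/perm_size/uniq_perm => //; apply: map_uniq uniq_fs.
rewrite -(size_map (@mainvar K r)) cardE -(size_map val).
apply/perm_size/uniq_perm => // [|k]; first by rewrite (map_inj_uniq val_inj) enum_uniq.
apply/mapP/mapP => [[f fs_f ->]|[i]].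
  have [j fj] : exists j : 'I_#|A|, mainvar f = enum_val j.
    by apply: mainvar_in; rewrite eqF.
  by exists (enum_val j) => //; rewrite mem_enum enum_valP.
rewrite mem_enum inE => /hasP[f Ff /eqP fi] ->.
by exists f; rewrite -?eqF.
Qed.

Lemma iota_system_triangular : triangular_system (iota_system S).
Proof.
have [_ [fs [eqF /andP[_ srt]]] divg _] := hS.
split=> /=.
- by rewrite card_tsF.
- exists (map (iota_mpoly A) fs); split.
    move=> f; apply/imfsetP/mapP => /= -[g Fg ->]; exists g => //.
      by rewrite -eqF.
    by rewrite eqF.
  apply/andP; split.
    apply/allP => _ /mapP[f fs_f ->]; have [|j /mainvar_iota] := @mainvar_in f.
      by rewrite eqF.
    by move/mainvar_ordP => [+ _]; apply: occurs_msize.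
  rewrite -map_comp sorted_map; move: srt; rewrite sorted_map.
  apply: (@sub_in_sorted _ (mem fs)); last exact/allP.
  move=> f g fs_f fs_g.
  have [|i fi] := @mainvar_in f; first by rewrite eqF.
  have [|j gj] := @mainvar_in g; first by rewrite eqF.
  have lt_rank (a b a' b' : nat) : a = enum_val i -> b = enum_val j ->
      a' = i -> b' = j -> (a < b)%N -> (a' < b')%N.
    by move=> -> -> -> ->; rewrite ltn_enum_val.
  exact: lt_rank fi gj (mainvar_iota fi) (mainvar_iota gj).
- move=> _ /imfsetP[f /= Ff ->]; have [q ->] := divg f Ff.
  have [j fj] := mainvar_in Ff.
  by exists (iota_mpoly A q); rewrite (LC_iota fj) rmorphM.
- move=> _ /imfsetP[f /= Ff ->]; have [j fj] := mainvar_in Ff.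
  by rewrite (mainvar_iota fj) card_tsF.
Qed.

Lemma iota_system_dense : dense (iota_system S).
Proof.
move=> j; have := enum_valP j; rewrite inE => /hasP[f Ff /eqP fj].
by exists (iota_mpoly A f); [apply: in_imfset | apply: mainvar_iota].
Qed.

End IotaSystem.

(** * Algebraic elements and nonvanishing values *)

Section Fractions.

Import FracField generic_quotient.
Local Open Scope quotient_scope.

Lemma fraction_exists (R : idomainType) (x : {fraction R}) :
  exists a b : R, b != 0 /\ x * tofrac b = tofrac a.
Proof.
elim/quotW: x => x; exists \n_x, \d_x; split; first exact: denom_ratioP.
rewrite -[LHS]/(mul _ _) !piE; apply/eqmodP; rewrite /= equivfE.
by rewrite /mulf !numden_Ratio ?mulf_neq0 ?denom_ratioP ?oner_eq0 // !mulr1 mulrC.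
Qed.

End Fractions.

Lemma clear_denominators (R : idomainType) (q : {poly {fraction R}}) :
  exists (p : {poly R}) (b : R), b != 0 /\ tofrac b *: q = map_poly (@tofrac R) p.
Proof.
elim/poly_ind: q => [|q c [p [b [b0 bq]]]].
  by exists 0, 1; rewrite oner_eq0 scaler0 rmorph0.
have [a [d [d0 cd]]] := fraction_exists c.
exists (d *: (p * 'X) + (b * a)%:P), (b * d); rewrite mulf_neq0 //; split=> //.
rewrite rmorphD /= map_polyZ [map_poly _ (p * _)]rmorphM /= map_polyX map_polyC /= -bq.
rewrite scalerDr; congr (_ + _); first by rewrite tofracM mulrC -scalerA scalerAl.
by rewrite -mul_polyC -polyCM !tofracM -mulrA [_ * c]mulrC cd.
Qed.

Lemma algebraic_over_numerators (R : idomainType) (M : fieldType)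
    (psi : {rmorphism {fraction R} -> M}) (z : M) : algebraicOver psi z ->
  exists2 p : {poly R}, p != 0 & root (map_poly (psi \o @tofrac R) p) z.
Proof.
move=> [q q0 qz]; have [p [b [b0 bq]]] := clear_denominators q.
exists p.
  apply: contraNneq q0 => p0; move/eqP: bq; rewrite p0 rmorph0 scaler_eq0.
  by rewrite tofrac_eq0 (negPf b0).
by rewrite map_poly_comp -bq map_polyZ rootZ // fmorph_eq0 tofrac_eq0.
Qed.

(** Pick a monomial m of the leading coefficient of q in T_k.  The coefficients
    of m form a nonzero polynomial in T_k over Om, which has a nonroot. *)
Lemma nonvanishing_value (Om : closedFieldType) (n : nat) (k : 'I_n)
    (q : {mpoly Om[n]}) :
  q != 0 -> exists c : Om,
    mmap (@mpolyC n Om) (fun i => if i == k then c%:MP else 'X_i) q != 0.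
Proof.
move=> q0; pose U := upoly k q.
have U0 : U != 0 by apply: contraNneq q0 => U0; rewrite -(upoly_X k q) -/U U0 horner0.
have [m lm] : exists m, (lead_coef U)@_m != 0.
  apply/not_all_not_ex => nz; case/negP: U0; rewrite -lead_coef_eq0; apply/eqP/mpolyP => m.
  by rewrite mcoeff0; apply/eqP; rewrite -[_ == _]negbK; apply/negP/nz.
pose Q := map_poly (mcoeff m) U.
have Q0 : Q != 0.
  apply: contraNneq lm => Q0.
  by rewrite lead_coefE -(coef_map (mcoeff m)) -/Q Q0 coef0.
have /closed_nonrootP[c Qc] := Q0; exists c.
have -> : mmap (@mpolyC n Om) (fun i => if i == k then c%:MP else 'X_i) q = U.[c%:MP].
  rewrite -[RHS]/(horner_eval c%:MP U) /U rmorph_mmap.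
  apply: eq_mmap => i /=; first by rewrite /horner_eval hornerC.
  rewrite /horner_eval -val_eqE /=.
  by case: eqP => _; rewrite ?hornerX ?hornerC.
apply: contraNneq Qc => Uc; apply/rootP.
rewrite (@horner_coef_wide _ (size U)) ?size_poly // -[RHS](mcoeff0 _ m) -Uc.
rewrite horner_coef raddf_sum.
by apply: eq_bigr => i _; rewrite /Q coef_map /= -rmorphXn /= [U`_i * _]mulrC mcoeffCM mulrC.
Qed.

(** The variables are replaced by constants one at a time. *)
Lemma nonvanishing_point (K : fieldType) (Om : closedFieldType)
    (phi : {rmorphism K -> Om}) (n : nat) (p : {mpoly K[n]}) :
  p != 0 -> exists t : 'I_n -> Om, mmap phi t p != 0.
Proof.
move=> p0; pose q := map_mpoly phi p.
have q0 : q != 0.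
  by apply: contraNneq p0 => q0; apply/eqP/(map_mpoly_inj (fmorph_inj phi));
     rewrite -/q q0 rmorph0.
have [t qt] : exists t : 'I_n -> Om, mmap (@mpolyC n Om)
    (fun i => if i \in enum 'I_n then (t i)%:MP else 'X_i) q != 0.
  elim: (enum 'I_n) => [|k ks [t qt]].
    exists (fun=> 0); rewrite (_ : mmap _ _ q = q) //.
    apply: (mpoly_rmorph_ext (f := mmap (@mpolyC n Om) _) (g := idfun)) => [c|i] /=.
      by rewrite mmapC.
    by rewrite mmapX mmap1U.
  have [c] := nonvanishing_value k qt; rewrite rmorph_mmap => qc.
  exists (fun i => if i \in ks then t i else c); apply: contraNneq qc => <-.
  apply/eqP/eq_mmap => [d|i] /=; first by rewrite mmapC.
  rewrite inE; case: ifP => _ /=; first by rewrite orbT mmapC.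
  by rewrite orbF mmapX mmap1U.
exists t; apply: contraNneq qt => qt; rewrite -mpolyC0 -qt rmorph_mmap.
rewrite /q rmorph_mmap; apply/eqP/eq_mmap => [c|i] /=; first by rewrite mmapC.
by rewrite mmapX mmap1U mem_enum.
Qed.

(** * Special values of a generic point *)

Section Points.

Variables (K : fieldType) (M Om : closedFieldType) (phi : {rmorphism K -> Om}).
Variables (m : nat) (gen : {rmorphism {mpoly K[m]} -> M}).
Hypothesis gen_inj : injective gen.
Local Notation P := {mpoly K[m]}.

Lemma coord_spec_eq0 (t : 'I_m -> Om) (p : P) : gen p = 0 -> mmap phi t p = 0.
Proof. by rewrite -(rmorph0 gen) => /gen_inj->; rewrite mmap0. Qed.

(** The values t are arbitrary: the variables are algebraically independent in
    M, since gen is injective. *)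
Definition coord_specialization (t : 'I_m -> Om) : specialization M Om :=
  Specialization (coord_spec_eq0 t).

Section Lifted.

Variables (t0 : 'I_m -> Om) (t : specialization M Om).
Variable (h : {rmorphism P -> sp_ring t}).
Hypothesis hext : @sp_ext _ _ (coord_specialization t0) t h.

Lemma sp_gen_mmap n (w : 'I_n -> sp_ring t) f :
  sp_gen t (mmap (h \o @mpolyC m K) w f) = mmap (gen \o @mpolyC m K) (sp_gen t \o w) f.
Proof. by rewrite rmorph_mmap; apply: eq_mmap => // c; apply: hext.1. Qed.

Lemma sp_val_mmap n (w : 'I_n -> sp_ring t) f :
  sp_val t (mmap (h \o @mpolyC m K) w f) = mmap phi (sp_val t \o w) f.
Proof.
rewrite rmorph_mmap; apply: eq_mmap => // c.
by have /= -> := hext.2 c%:MP; rewrite mmapC.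
Qed.

End Lifted.

(** The equations of the coordinates of Y and of 1/g(Y) have leading
    coefficients in K[T]; t0 is a point where their product d does not vanish,
    so that none of these elements is sent to infinity.  Having 1/g(Y) among
    them keeps g(Y) from being sent to 0. *)
Lemma closed_point (n : nat) (Y : 'I_n -> M) (F : {mpoly K[n]} -> Prop)
    (g : {mpoly K[n]}) :
    (forall z : M, exists2 p : {poly P}, p != 0 & root (map_poly gen p) z) ->
    (forall f, F f -> mmap (gen \o @mpolyC m K) Y f = 0) ->
    mmap (gen \o @mpolyC m K) Y g <> 0 ->
  exists x : 'I_n -> Om,
    (forall f, F f -> mmap phi x f = 0) /\ mmap phi x g <> 0.
Proof.
move=> algM FY gY.
pose zs := (mmap (gen \o @mpolyC m K) Y g)^-1 :: [seq Y i | i <- enum 'I_n].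
have [d [d0 dP]] : exists d : P, d != 0 /\ forall z, z \in zs ->
    exists2 p : {poly P}, root (map_poly gen p) z & exists q, d = lead_coef p * q.
  elim: zs => [|z zs [d [d0 dP]]]; first by exists 1; rewrite oner_neq0.
  have [p p0 pz] := algM z; exists (lead_coef p * d).
  rewrite mulf_neq0 ?lead_coef_eq0 //; split=> // z'; rewrite inE.
  case/predU1P => [->|/dP[p' p'z [q ->]]]; first by exists p => //; exists d.
  by exists p' => //; exists (lead_coef p * q); rewrite mulrCA.
have [t0 dt0] := nonvanishing_point phi d0.
have [z zs_z|t [h [hext [us gus]]]] := @reach_all M Om (coord_specialization t0) zs.
  have [p pz [q dpq]] := dP z zs_z; exists p; split=> //=.
  by apply: contraNneq dt0; rewrite dpq rmorphM /= => ->; rewrite mul0r.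
have reach z : z \in zs -> exists w, sp_gen t w = z.
  by rewrite -gus => /mapP[w _ ->]; exists w.
have /fin_all_exists[w gw] (i : 'I_n) : exists w, sp_gen t w = Y i.
  by apply: reach; rewrite inE map_f ?orbT // mem_enum.
have [u gu] := reach _ (mem_head _ _).
have Yf f : sp_gen t (mmap (h \o @mpolyC m K) w f) = mmap (gen \o @mpolyC m K) Y f.
  by rewrite (sp_gen_mmap hext); apply: eq_mmap.
exists (sp_val t \o w); split=> [f Ff|].
  by rewrite -(sp_val_mmap hext); apply: sp_gen_eq0; rewrite Yf FY.
rewrite -(sp_val_mmap hext) => vg0.
have : sp_val t (mmap (h \o @mpolyC m K) w g * u) = sp_val t 1.
  by apply: sp_val_gen_eq; rewrite rmorphM Yf gu rmorph1 mulfV //; apply/eqP.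
by rewrite rmorphM vg0 mul0r rmorph1 => /eqP; rewrite eq_sym oner_eq0.
Qed.

End Points.

(** * Lifting a solution to the generic point *)

Section GenericPoint.

Variables (K : fieldType) (M Om : closedFieldType) (phi : {rmorphism K -> Om}).
Variables (r : nat) (A : {set 'I_r}).
Local Notation m := #|[predC A]|.
Local Notation P := {mpoly K[m]}.
Variable gen : {rmorphism P -> M}.
Hypothesis gen_inj : injective gen.

Variables (F : seq {mpoly K[r]}) (g : {mpoly K[r]}) (x : 'I_r -> Om).
Hypothesis mainvarF : forall f, f \in F -> exists2 i, i \in A & mainvar f = i.
Hypothesis A_mainvar : forall i, i \in A -> exists2 f, f \in F & mainvar f = i.
Hypothesis mainvar_inj : {in F &, injective (@mainvar K r)}.
Hypothesis LC_dvd : forall f, f \in F -> exists q, g = q * LC f.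
Hypothesis Fx : forall f, f \in F -> mmap phi x f = 0.
Hypothesis gx : mmap phi x g <> 0.

Local Notation s0 := (coord_specialization phi gen_inj (fun j => x (enum_val j))).

(** The state of the construction when the variables of A with index at least k
    are treated: x is lifted in these coordinates and outside A, and the lift
    solves the polynomials with main variable at least k.  The other coordinates
    of w are arbitrary. *)
Definition partial_lift (k : nat) := exists (t : specialization M Om)
    (h : {rmorphism P -> sp_ring t}) (w : 'I_r -> sp_ring t),
  [/\ @sp_ext _ _ s0 t h,
      forall i : 'I_r, (i \in A -> (k <= i)%N) -> sp_val t (w i) = x i,
      forall j : 'I_m, sp_gen t (w (enum_val j)) = gen 'X_j
    & forall f, f \in F -> (k <= mainvar f)%N ->
        mmap (gen \o @mpolyC m K) (sp_gen t \o w) f = 0].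

Lemma partial_lift_start : partial_lift r.
Proof.
pose w (i : 'I_r) : P := if [pick j : 'I_m | enum_val j == i] is Some j then 'X_j else 0.
have wE (j : 'I_m) : w (enum_val j) = 'X_j.
  rewrite /w; case: pickP => [j' /eqP/enum_val_inj->//|/(_ j)].
  by rewrite eqxx.
exists s0, idfun, w; split=> //.
- move=> i iA; have i_nA : i \in [predC A].
    by rewrite inE /=; apply/negP => /iA; rewrite leqNgt ltn_ord.
  by rewrite -(enum_rankK_in i_nA i_nA) wE /= mmapX mmap1U.
- by move=> j; rewrite wE.
- by move=> f /mainvarF[i _ ->]; rewrite leqNgt ltn_ord.
Qed.

Lemma partial_lift_skip (k : 'I_r) :
  k \notin A -> partial_lift k.+1 -> partial_lift k.
Proof.
move=> kA [t [h [w [hext wx wX Fw]]]]; exists t, h, w; split=> //.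
  move=> i ik; apply: wx => iA; rewrite ltn_neqAle ik // andbT.
  by apply: contraNneq kA => /val_inj->.
move=> f Ff; rewrite leq_eqVlt => /predU1P[kf|]; last exact: Fw.
by have [i iA] := mainvarF Ff; rewrite -kf => /val_inj ki; rewrite ki iA in kA.
Qed.

(** The coefficients of f in T_k involve only variables that are already lifted,
    so q specializes to f(T_k, x_(k+1), ...), which has root x_k and leading
    coefficient LC(f)(x), nonzero because it divides g(x). *)
Lemma partial_lift_root (k : 'I_r) (f : {mpoly K[r]}) :
  f \in F -> mainvar f = k -> partial_lift k.+1 -> partial_lift k.
Proof.
move=> Ff fk [t [h [w [hext wx wX Fw]]]].
have [occ_k min_k] := (mainvar_ordP f k).1 fk.
have kA : k \in A by have [i iA] := mainvarF Ff; rewrite fk => /val_inj->.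
pose q := map_poly (mmap (h \o @mpolyC m K) w) (upoly k f).
have qx : map_poly (sp_val t) q = map_poly (mmap phi x) (upoly k f).
  rewrite -map_poly_comp /= (eq_map_poly (sp_val_mmap hext w)) /upoly !rmorph_mmap.
  apply: eq_mmap_occurs => [c|i occ_i] /=; first by rewrite !map_polyC /= !mmapC.
  case: eqP => [_|ik]; first by rewrite !map_polyX.
  rewrite !map_polyC /= !mmapX !mmap1U /= wx // => _.
  rewrite ltn_neqAle eq_sym; apply/andP; split; first exact/eqP.
  by rewrite leqNgt; apply/negP => /min_k; rewrite occ_i.
have lcx : mmap phi x (LC f) != 0.
  have [p gp] := LC_dvd Ff; apply/eqP => lc0.
  by apply: gx; rewrite gp rmorphM /= lc0 mulr0.
have lcq : sp_val t (lead_coef q) != 0.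
  (* The size cannot drop in W, since it does not drop at x. *)
  have sq : size q = size (upoly k f).
    apply/eqP; rewrite eqn_leq size_poly /=.
    apply: leq_trans (size_poly _ (fun i => sp_val t q`_i)).
    rewrite -/(map_poly (sp_val t) q) qx size_map_poly_id0 //.
    by move: lcx; rewrite /LC mainpolyE fk.
  rewrite lead_coefE sq -coef_map qx coef_map -lead_coefE /=.
  by move: lcx; rewrite /LC mainpolyE fk.
have qxk : root (map_poly (sp_val t) q) (x k).
  rewrite qx; apply/rootP.
  rewrite -[X in _.[X]](_ : mmap phi x 'X_k = x k); last by rewrite mmapX mmap1U.
  by rewrite horner_map /= upoly_X Fx.
have [t' [h' [h'ext [u [ux uroot]]]]] := lift_root lcq qxk.
pose w' i := if i == k then u else h' (w i).
have gw' i : i != k -> sp_gen t' (w' i) = sp_gen t (w i).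
  by move=> ik; rewrite /w' (negPf ik); apply: h'ext.1.
exists t', (h' \o h), w'; split.
- exact: sp_ext_trans hext h'ext.
- move=> i ik; rewrite /w'; case: eqVneq => [->//|ne_ik].
  rewrite (h'ext.2 (w i) : sp_val t' (h' _) = _); apply: wx => iA.
  rewrite ltn_neqAle ik // andbT.
  by rewrite eq_sym.
- move=> j; rewrite gw' //; apply: contraTneq (enum_valP j) => ->.
  by rewrite inE /= kA.
- move=> f' Ff'; rewrite leq_eqVlt => /predU1P[kf'|lt_kf'].
    have -> : f' = f by apply: mainvar_inj => //; rewrite fk -kf'.
    have <- : (map_poly (sp_gen t) q).[sp_gen t' u] =
              mmap (gen \o @mpolyC m K) (sp_gen t' \o w') f; last exact/rootP.
    rewrite /q -map_poly_comp (eq_map_poly (sp_gen_mmap hext w)) /upoly rmorph_mmap.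
    rewrite -[LHS]/(horner_eval _ _) rmorph_mmap; apply: eq_mmap => i /=.
      by rewrite map_polyC /= mmapC /horner_eval hornerC.
    case: (eqVneq i k) => [->|ik].
      by rewrite eqxx map_polyX /horner_eval hornerX /w' eqxx.
    rewrite (inj_eq val_inj) (negPf ik) map_polyC /= mmapX mmap1U /horner_eval hornerC.
    by rewrite gw'.
  (* The main variable of f' is beyond k, so the new coordinate does not
     occur in f'. *)
  rewrite -[RHS](Fw f' Ff' lt_kf'); apply: eq_mmap_occurs => // i occ_i /=.
  apply: gw'; apply: contraTneq occ_i => ->.
  have [i' _ f'i'] := mainvarF Ff'; have [_] := (mainvar_ordP f' i').1 f'i'.
  by apply; rewrite -f'i'.
Qed.

(** The lift of g is nonzero in M because its special value g(x) is. *)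
Lemma generic_point : exists Y : 'I_r -> M,
  [/\ forall j : 'I_m, Y (enum_val j) = gen 'X_j,
      forall f, f \in F -> mmap (gen \o @mpolyC m K) Y f = 0
    & mmap (gen \o @mpolyC m K) Y g <> 0].
Proof.
have [t [h [w [hext wx wX Fw]]]] : partial_lift 0.
  suff lifts n : (n <= r)%N -> partial_lift (r - n) by rewrite -(subnn r); apply: lifts.
  elim: n => [|n IH] lt_nr; first by rewrite subn0; apply: partial_lift_start.
  have lt_kr : (r - n.+1 < r)%N by rewrite ltn_subrL (leq_ltn_trans _ lt_nr).
  have {IH} : partial_lift (Ordinal lt_kr).+1 by rewrite /= -subSn // subSS; apply/IH/ltnW.
  rewrite -[(r - n.+1)%N]/(val (Ordinal lt_kr)); move: (Ordinal lt_kr) => k lift_k.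
  have [/A_mainvar[f Ff fk]|kA] := boolP (k \in A).
    exact: partial_lift_root Ff fk lift_k.
  exact: partial_lift_skip kA lift_k.
exists (sp_gen t \o w); split=> // [f Ff|]; first exact: Fw.
rewrite -(sp_gen_mmap hext) => /sp_gen_eq0; rewrite (sp_val_mmap hext) => g0.
by apply: gx; rewrite -[RHS]g0; apply: eq_mmap => // i; rewrite /= wx.
Qed.

End GenericPoint.

(** * The main equivalence *)

Lemma meval_iota (K : fieldType) (r : nat) (A : {set 'I_r}) (M : fieldType)
    (psi : {rmorphism ratfield K A -> M}) (y : 'I_#|A| -> M) (Y : 'I_r -> M) f :
    (forall j : 'I_#|A|, Y (enum_val j) = y j) ->
    (forall j : 'I_#|[predC A]|, Y (enum_val j) = psi (tofrac 'X_j)) ->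
  (map_mpoly psi (iota_mpoly A f)).@[y]
    = mmap (psi \o @tofrac _ \o @mpolyC #|[predC A]| K) Y f.
Proof.
move=> Yin Yout; rewrite meval_map_mpoly.
apply: (mpoly_rmorph_ext (f := mmap psi y \o @iota_mpoly K r A)
  (g := mmap (psi \o @tofrac _ \o @mpolyC #|[predC A]| K) Y)) => [c|] /=.
  by rewrite iota_mpolyC !mmapC.
apply: (var_split_ind (A := A)) => j; rewrite [RHS]mmapX mmap1U.
  by rewrite iota_mpoly_in mmapX mmap1U Yin.
by rewrite iota_mpoly_notin mmapC Yout.
Qed.

Lemma uniq_map_inj (T T' : eqType) (f : T -> T') (s : seq T) :
  uniq (map f s) -> {in s &, injective f}.
Proof.
elim: s => //= z s IH /andP[fz us] x y; rewrite !inE.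
case/predU1P => [->|sx] /predU1P[->|sy] // fxy; last exact: IH.
  by rewrite fxy map_f in fz.
by rewrite -fxy map_f in fz.
Qed.

Lemma mainvar_inj_tsF (K : fieldType) (r : nat) (S : tsystem K r) :
  triangular_system S -> {in tsF S &, injective (@mainvar K r)}.
Proof.
move=> [_ [fs [eqF /andP[_ srt]]] _ _].
move: srt; rewrite ltn_sorted_uniq_leq => /andP[u_fs _].
by move=> f g Ff Fg; apply: (uniq_map_inj u_fs); rewrite -eqF.
Qed.

Theorem proposition3p1 (K : fieldType) (r : nat) (S : tsystem K r)
    (hS : triangular_system S) :
  [/\ triangular_system (iota_system S),
      dense (iota_system S)
    & forall (Kbar : closedFieldType) (phi : {rmorphism K -> Kbar})
             (Lbar : closedFieldType)
             (psi : {rmorphism ratfield K (mainvars S) -> Lbar}),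
        is_alg_closure phi -> is_alg_closure psi ->
        ((exists x : 'I_r -> Kbar, solset phi S x) <->
         (exists y : 'I_#|mainvars S| -> Lbar,
            solset psi (iota_system S) y))].
Proof.
split; first exact: iota_system_triangular.
  exact: iota_system_dense.
move=> Kbar phi Lbar psi _ alg_psi; set A := mainvars S.
pose gen : {rmorphism {mpoly K[#|[predC A]|]} -> Lbar} := psi \o @tofrac _.
have gen_inj : injective gen.
  by move=> p q /fmorph_inj/eqP; rewrite tofrac_eq => /eqP.
split=> [[x [Fx gx]]|[y [Fy gy]]].
  have [||||||Y [YX FY gY]] := @generic_point K Lbar Kbar phi r A gen gen_inj
      (enum_fset (tsF S)) (tsg S) x.
  - move=> f Ff; have [j fj] := mainvar_in hS Ff.
    by exists (enum_val j) => //; apply: enum_valP.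
  - by move=> i; rewrite inE => /hasP[f Ff /eqP fi]; exists f.
  - exact: mainvar_inj_tsF.
  - by case: hS.
  - by move=> f Ff; rewrite -meval_map_mpoly; apply: Fx.
  - by rewrite -meval_map_mpoly.
  have evalE f : (map_mpoly psi (iota_mpoly A f)).@[fun j => Y (enum_val j)]
      = mmap (gen \o @mpolyC _ K) Y f by apply: meval_iota.
  exists (fun j => Y (enum_val j)); split=> [_ /imfsetP[f /= Ff ->]|].
    by rewrite evalE FY.
  by rewrite evalE.
pose Y (i : 'I_r) : Lbar := (map_mpoly psi (iota_mpoly A 'X_i)).@[y].
have evalE f : (map_mpoly psi (iota_mpoly A f)).@[y] = mmap (gen \o @mpolyC _ K) Y f.
  apply: meval_iota => j.
    by rewrite /Y iota_mpoly_in map_mpolyX mevalXU.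
  by rewrite /Y iota_mpoly_notin map_mpolyC mevalC.
have algP z : exists2 p : {poly {mpoly K[#|[predC A]|]}}, p != 0 & root (map_poly gen p) z.
  exact: (algebraic_over_numerators (alg_psi z)).
have [||x [Fx gx]] := @closed_point K Lbar Kbar phi _ gen gen_inj r Y
    (fun f => f \in tsF S) (tsg S) algP.
- by move=> f Ff; rewrite -evalE; apply: Fy; apply: in_imfset.
- by rewrite -evalE.
exists x; split=> [f Ff|]; rewrite meval_map_mpoly //; exact: Fx.
Qed.
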